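(* Let $A_0,A_1,\dots,A_L\in\mathbb{R}^{n\times n}$, $q_0,q_1,\dots,q_L\in\mathbb{R}^n$, and $$\mathcal{U}_A=\Big\{(M,q): M=A^TA,\ A=A_0+\sum_{l=1}^L\xi_lA_l,\ q=q_0+\sum_{l=1}^L\xi_lq_l,\ \|\xi\|_2\le 1\Big\}.$$ Consider the semi-infinite program in $(x,t)\in\mathbb{R}^n\times\mathbb{R}$ $$\begin{array}{rl}\min & t\\ \text{subject to} & x^T(Mx+q)\le t,\quad\forall(M,q)\in\mathcal{U}_A,\\ & Mx+q\ge 0,\quad\forall(M,q)\in\mathcal{U}_A,\\ & x\ge 0.\end{array}$$ Then this program has a tractable robust counterpart given by the following semidefinite program in the variables $t,\tau\in\mathbb{R}$, $x\in\mathbb{R}^n$, and $y_{i,1},y_{i,2}\in\mathbb{R}$ ($i=1,\dots,n$): $$\begin{array}{rll}\min & t\\ \text{subject to} & \tau\begin{pmatrix}-1&&\\&I_L&\\&&0_{n\times n}\end{pmatrix}+t\begin{pmatrix}1&\\&0_{(L+n)\times(L+n)}\end{pmatrix}+M_0(x)\succeq 0,\\ & y_{i,1}\begin{pmatrix}0&\\&-I_L\end{pmatrix}+y_{i,2}\begin{pmatrix}-1&\\&0_{L\times L}\end{pmatrix}+M_i(x)\succeq 0,& i=1,\dots,n,\\ & y_{i,1}+y_{i,2}+a_i(x)\ge 0,& i=1,\dots,n,\\ & y_{i,1}\le 0,& i=1,\dots,n,\\ & x\ge 0,\end{array}$$ where $M_0(\cdot)$, $M_i(\cdot)$ and $a_i(\cdot)$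 are the affine functions of $x$ specified in the context.
   Context: $[B]_{i\bullet}$ is the $i$-th row of $B$, $[v]_i$ the $i$-th entry of $v$; $X\succeq 0$ means $X$ is symmetric positive semidefinite; blank blocks are zero; vector inequalities are componentwise. ''Tractable robust counterpart given by the SDP'' means: $(x,t)$ is feasible for the semi-infinite program if and only if there exist $\tau$ and $(y_{i,1},y_{i,2})_{i=1}^n$ such that $(t,\tau,x,y)$ is feasible for the SDP (so the two problems are equivalent). The functions are as follows. $M_0(x)\in\mathbb{R}^{(L+n+1)\times(L+n+1)}$ is the symmetric matrix $$M_0(x)=\begin{pmatrix}-q_0^Tx&-\tfrac12q_1^Tx&\cdots&-\tfrac12q_L^Tx&(A_0x)^T\\ -\tfrac12q_1^Tx&0&\cdots&0&(A_1x)^T\\ \vdots&\vdots&&\vdots&\vdots\\ -\tfrac12q_L^Tx&0&\cdots&0&(A_Lx)^T\\ A_0x&A_1x&\cdots&A_Lx&I_n\end{pmatrix}.$$ For $i=1,\dots,n$: $a_i(x)=[A_0^TA_0]_{i\bullet}x+[q_0]_i$, and $M_i(x)=\begin{pmatrix}0&\tfrac12b_i(x)^T\\ \tfrac12b_i(x)&C_i(x)\end{pmatrix}\in\mathbb{R}^{(L+1)\times(L+1)}$, where $(b_i(x))_l=[A_l^TA_0+A_0^TA_l]_{i\bullet}x+[q_l]_i$ for $l=1,\dots,L$ and $(C_i(x))_{lm}=\tfrac12[A_l^TA_m+A_m^TA_l]_{i\bullet}x$ for $l,m=1,\dots,L$. *)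

(* Defs.v *)
From HB Require Import structures.
From mathcomp Require Import all_boot all_order all_algebra.
From mathcomp Require Import boolp classical_sets reals.

Set Implicit Arguments.
Unset Strict Implicit.
Unset Printing Implicit Defensive.

Import Order.TTheory GRing.Theory Num.Theory.
Local Open Scope ring_scope.
Local Open Scope classical_set_scope.

Definition dotv (R : realType) (n : nat) (u v : 'cV[R]_n) : R :=
  (u^T *m v) 0 0.

(* The normed-module norm of MathComp-Analysis on 'cV_n is the sup norm, hence
   an explicit Euclidean norm. *)
Definition norm2 (R : realType) (n : nat) (v : 'cV[R]_n) : R :=
  Num.sqrt (\sum_(i < n) v i 0 ^+ 2).

Definition nonneg_vec (R : realType) (n : nat) (v : 'cV[R]_n) : Prop :=
  forall i, 0 <= v i 0.

Definition psd (R : realType) (n : nat) (X : 'M[R]_n) : Prop :=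
  X^T = X /\ forall v : 'cV[R]_n, 0 <= dotv v (X *m v).

Definition uncertainty_set (R : realType) (n L : nat)
    (A0 : 'M[R]_n) (A : 'I_L -> 'M[R]_n)
    (q0 : 'cV[R]_n) (q : 'I_L -> 'cV[R]_n) : set ('M[R]_n * 'cV[R]_n) :=
  [set Mq | exists xi : 'cV[R]_L, norm2 xi <= 1 /\
     let Axi := A0 + \sum_(l < L) xi l 0 *: A l in
     Mq.1 = Axi^T *m Axi /\ Mq.2 = q0 + \sum_(l < L) xi l 0 *: q l].

Definition semi_infinite_feasible (R : realType) (n : nat)
    (U : set ('M[R]_n * 'cV[R]_n)) (x : 'cV[R]_n) (t : R) : Prop :=
  [/\ forall M q, U (M, q) -> dotv x (M *m x + q) <= t,
      forall M q, U (M, q) -> nonneg_vec (M *m x + q)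
    & nonneg_vec x].

Section SDPData.

Variables (R : realType) (n L : nat).
Variables (A0 : 'M[R]_n) (A : 'I_L -> 'M[R]_n).
Variables (q0 : 'cV[R]_n) (q : 'I_L -> 'cV[R]_n).
Implicit Types (x : 'cV[R]_n) (t tau : R) (i : 'I_n).

(* The index set of size 1 + (L + n) is split into the blocks 1, L and n. *)
Definition M0_mx x : 'M[R]_(1 + (L + n)) :=
  let qx : 'cV[R]_L := \col_l (- (2^-1 * dotv (q l) x)) in
  let Ax : 'M[R]_(n, L) := \matrix_(i, l) (A l *m x) i 0 in
  block_mx
    (- dotv q0 x)%:M              (row_mx qx^T (A0 *m x)^T)
    (col_mx qx (A0 *m x))         (block_mx 0 Ax^T Ax 1%:M).

Definition a_coef i x : R := (row i (A0^T *m A0) *m x) 0 0 + q0 i 0.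

Definition b_coef i x : 'cV[R]_L :=
  \col_l ((row i ((A l)^T *m A0 + A0^T *m A l) *m x) 0 0 + q l i 0).

Definition C_coef i x : 'M[R]_L :=
  \matrix_(l, m)
    (2^-1 * (row i ((A l)^T *m A m + (A m)^T *m A l) *m x) 0 0).

Definition Mi_mx i x : 'M[R]_(1 + L) :=
  block_mx 0 (2^-1 *: (b_coef i x)^T) (2^-1 *: b_coef i x) (C_coef i x).

Definition sdp_feasible t tau x (y1 y2 : 'I_n -> R) : Prop :=
  [/\ psd (tau *: (block_mx (- 1%:M) 0
                            0        (block_mx 1%:M 0 0 0)
                     : 'M[R]_(1 + (L + n)))
           + t *: (block_mx 1%:M 0 0 0 : 'M[R]_(1 + (L + n)))
           + M0_mx x),
      forall i, psd (y1 i *: (block_mx 0 0 0 (- 1%:M) : 'M[R]_(1 + L))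
                     + y2 i *: (block_mx (- 1%:M) 0 0 0 : 'M[R]_(1 + L))
                     + Mi_mx i x),
      forall i, 0 <= y1 i + y2 i + a_coef i x,
      forall i, y1 i <= 0
    & nonneg_vec x].

End SDPData.

(* Main.v *)
(** The ball constraints are handled by the homogeneous S-lemma: if [F >= 0]
    wherever [G >= 0], then [F - lam G >= 0] everywhere for some [lam >= 0].
    The multiplier is the infimum of [F u / G u] over [G u > 0]; that it is
    large enough for every [v] with [G v < 0] is seen in the plane spanned by
    [u] and [v], where [G] vanishes at two points [u + r v] with [r] of opposite signs.
    The quadratic term of the first constraint is then linearised by a Schur
    complement, i.e. by completing the square in the last [n] variables. *)
Require Import Defs.
From mathcomp Require Import all_boot all_order all_algebra.
From mathcomp Require Import boolp classical_sets reals.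
From mathcomp Require Import ring lra.

Set Implicit Arguments.
Unset Strict Implicit.
Unset Printing Implicit Defensive.

Import Order.TTheory GRing.Theory Num.Theory.
Local Open Scope ring_scope.

(** * Bilinearity and positivity of the Euclidean inner product *)

Section DotProduct.
Variable R : realType.

Lemma dotvE n (u v : 'cV[R]_n) : dotv u v = \sum_i u i 0 * v i 0.
Proof. by rewrite /dotv mxE; apply: eq_bigr => i _; rewrite mxE. Qed.

Lemma dotvC n (u v : 'cV[R]_n) : dotv u v = dotv v u.
Proof. by rewrite !dotvE; apply: eq_bigr => i _; rewrite mulrC. Qed.

Lemma dotvDr n (u v w : 'cV[R]_n) : dotv u (v + w) = dotv u v + dotv u w.
Proof. by rewrite /dotv mulmxDr mxE. Qed.

Lemma dotvDl n (u v w : 'cV[R]_n) : dotv (u + v) w = dotv u w + dotv v w.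
Proof. by rewrite dotvC dotvDr !(dotvC w). Qed.

Lemma dotvZr n (u v : 'cV[R]_n) c : dotv u (c *: v) = c * dotv u v.
Proof. by rewrite /dotv -scalemxAr mxE. Qed.

Lemma dotvZl n (u v : 'cV[R]_n) c : dotv (c *: u) v = c * dotv u v.
Proof. by rewrite dotvC dotvZr dotvC. Qed.

Lemma dotvNr n (u v : 'cV[R]_n) : dotv u (- v) = - dotv u v.
Proof. by rewrite -scaleN1r dotvZr mulN1r. Qed.

Lemma dotvNl n (u v : 'cV[R]_n) : dotv (- u) v = - dotv u v.
Proof. by rewrite dotvC dotvNr dotvC. Qed.

Lemma dotv0r n (u : 'cV[R]_n) : dotv u 0 = 0.
Proof. by rewrite /dotv mulmx0 mxE. Qed.

Lemma dotv_ge0 n (u : 'cV[R]_n) : 0 <= dotv u u.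
Proof. by rewrite dotvE sumr_ge0 // => i _; rewrite -expr2 sqr_ge0. Qed.

Lemma dotv_eq0 n (u : 'cV[R]_n) : dotv u u = 0 -> u = 0.
Proof.
rewrite dotvE => /eqP; rewrite psumr_eq0; last first.
  by move=> i _; rewrite -expr2 sqr_ge0.
move=> /allP u0; apply/matrixP => i j; rewrite (ord1 j) mxE.
have /= := u0 i (mem_index_enum _).
by rewrite mulf_eq0 orbb => /eqP.
Qed.

Lemma dotv_mulmxr m n (u : 'cV[R]_m) (M : 'M[R]_(m, n)) (v : 'cV[R]_n) :
  dotv u (M *m v) = dotv (M^T *m u) v.
Proof. by rewrite /dotv trmx_mul trmxK mulmxA. Qed.

Lemma row_mulE m p (i : 'I_m) (M : 'M[R]_(m, p)) (v : 'cV[R]_p) :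
  (row i M *m v) 0 0 = (M *m v) i 0.
Proof. by rewrite -row_mul mxE. Qed.

Lemma dotv_col_mx m n (a c : 'cV[R]_m) (b d : 'cV[R]_n) :
  dotv (col_mx a b) (col_mx c d) = dotv a c + dotv b d.
Proof. by rewrite /dotv tr_col_mx mul_row_col mxE. Qed.

Lemma dotv_scalar (s r : R) : dotv s%:M r%:M = s * r.
Proof. by rewrite dotvE big_ord1 !mxE !mulr1n. Qed.

Lemma norm2_le1 n (u : 'cV[R]_n) : (norm2 u <= 1) = (dotv u u <= 1).
Proof.
have -> : norm2 u = Num.sqrt (dotv u u).
  by rewrite /norm2 dotvE; congr Num.sqrt; apply: eq_bigr => i _; rewrite expr2.
by rewrite -[X in _ <= X]sqrtr1 ler_sqrt.
Qed.

End DotProduct.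

(** * The S-lemma, its form for the unit ball, and block quadratic forms *)

Section SLemma.
Variable R : realType.

(** As [g * k < 0], the discriminant exceeds [h ^+ 2], so its root [d] dominates both [h] and [- h],
    which fixes the signs of the roots. The identity [g = k * (r1 * r2)] is Vieta's. *)
Lemma quadratic_roots_opposite_signs (g h k : R) : 0 < g -> k < 0 ->
  exists r1 r2 : R, [/\ r1 < 0, 0 < r2, g = k * (r1 * r2),
     g + r1 * h + r1 ^+ 2 * k = 0 & g + r2 * h + r2 ^+ 2 * k = 0].
Proof.
move=> g0 k0; pose D := h ^+ 2 - 4 * g * k; pose d := Num.sqrt D.
have D0 : h ^+ 2 < D by rewrite /D; nra.
have dE : d ^+ 2 = D by rewrite sqr_sqrtr // (le_trans (sqr_ge0 h)) // ltW.
have d0 : 0 <= d by exact: sqrtr_ge0.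
have [hd hNd] : h < d /\ - h < d by split; nra.
have k2 : 2 * k != 0 by lra.
have kN : (2 * k)^-1 < 0 by rewrite invr_lt0; lra.
(* In each of the three equations below, the two sides differ by exactly this fraction. *)
have zero : (d ^+ 2 - h ^+ 2 + 4 * g * k) / (4 * k) = 0.
  by rewrite dE /D [X in X / _](_ : _ = 0) ?mul0r //; ring.
exists ((d - h) / (2 * k)), ((- d - h) / (2 * k)); split.
- by rewrite pmulr_rlt0 //; lra.
- by rewrite nmulr_rgt0 //; lra.
- by apply: subr0_eq; rewrite -zero; field; lra.
- by rewrite -zero; field; lra.
- by rewrite -zero; field; lra.
Qed.

Lemma s_lemma n (P Q : 'M[R]_n) (u0 : 'cV[R]_n) :
  0 < dotv u0 (Q *m u0) ->
  (forall v, 0 <= dotv v (Q *m v) -> 0 <= dotv v (P *m v)) ->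
  exists2 lam, 0 <= lam &
    forall v, lam * dotv v (Q *m v) <= dotv v (P *m v).
Proof.
move=> Qu0 PQ.
have qformD (M : 'M[R]_n) u v r : dotv (u + r *: v) (M *m (u + r *: v)) =
    dotv u (M *m u) + r * (dotv u (M *m v) + dotv v (M *m u))
      + r ^+ 2 * dotv v (M *m v).
  rewrite mulmxDr -scalemxAr !(dotvDl, dotvDr, dotvZl, dotvZr); ring.
pose F v := dotv v (P *m v); pose G v := dotv v (Q *m v).
(* Division-free form of [F v / G v <= F u / G u]. *)
have cross u v : 0 < G u -> G v < 0 -> F u * G v <= F v * G u.
  move=> Gu Gv.
  have [r1 [r2 [r1N r2P Guv z1 z2]]] := quadratic_roots_opposite_signs
    (dotv u (Q *m v) + dotv v (Q *m u)) Gu Gv.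
  have := PQ (u + r1 *: v); rewrite !qformD z1 lexx => /(_ isT) F1.
  have := PQ (u + r2 *: v); rewrite !qformD z2 lexx => /(_ isT) F2.
  (* The positive weights [r2] and [- r1] on the two values of [F] cancel the cross term [h]. *)
  have le1 : 0 <= (r2 - r1) * (F u - r1 * r2 * F v).
    move: F1 F2; rewrite -/(F u) -/(F v); set h := dotv _ _ + _ => F1 F2.
    have : 0 <= r2 * (F u + r1 * h + r1 ^+ 2 * F v)
              - r1 * (F u + r2 * h + r2 ^+ 2 * F v).
      rewrite subr_ge0 (le_trans (mulr_le0_ge0 (ltW r1N) F2)) //.
      by rewrite mulr_ge0 // ltW.
    by congr (0 <= _); ring.
  have : 0 <= F u - r1 * r2 * F v.
    by rewrite -(pmulr_rge0 _ (_ : 0 < r2 - r1)) //; lra.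
  by rewrite Guv => le2; rewrite -subr_le0; nra.
pose S : set R := [set c | exists2 u, 0 < G u & c = F u / G u]%classic.
have S0 : (S !=set0)%classic by exists (F u0 / G u0); exists u0.
have lbS c : (forall u, 0 < G u -> c * G u <= F u) -> c <= inf S.
  move=> cP; apply: lb_le_inf => // _ [u Gu ->].
  by rewrite ler_pdivlMr // cP.
have S_lb : has_lbound S.
  by exists 0 => _ [u Gu ->]; apply: divr_ge0; [exact/PQ/ltW|exact/ltW].
exists (inf S); first by apply: lbS => u Gu; rewrite mul0r; exact/PQ/ltW.
move=> v; rewrite -/(F v) -/(G v); case: (ltgtP (G v) 0) => [Gv|Gv|Gv].
- rewrite -ler_ndivrMr //; apply: lbS => u Gu.
  rewrite mulrAC ler_ndivrMr //; exact: cross.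
- by rewrite -ler_pdivlMr //; apply: ge_inf => //; exists v.
- by rewrite Gv mulr0; apply: PQ; rewrite -/(G v) Gv.
Qed.

Lemma qform_block_mx n (a : R) (b c : 'cV[R]_n) (C : 'M[R]_n) s xi :
  dotv (col_mx s%:M xi) (block_mx a%:M b^T c C *m col_mx s%:M xi) =
    a * s ^+ 2 + s * (dotv b xi + dotv c xi) + dotv xi (C *m xi).
Proof.
rewrite mul_block_col dotv_col_mx -scalar_mxM !mul_mx_scalar.
rewrite !dotvDr dotv_scalar dotvZr (dotvC xi c) [b^T *m xi]mx11_scalar.
by rewrite dotv_scalar -/(dotv b xi); ring.
Qed.

(** Homogenising with an extra coordinate [s] turns the ball into the cone where
    [s ^+ 2 - dotv xi xi] is nonnegative, to which [s_lemma] applies. *)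
Lemma s_lemma_ball n (a : R) (b : 'cV[R]_n) (C : 'M[R]_n) :
  (forall xi, dotv xi xi <= 1 -> 0 <= a + dotv b xi + dotv xi (C *m xi)) ->
  exists2 lam, 0 <= lam & forall s xi,
    lam * (s ^+ 2 - dotv xi xi)
      <= a * s ^+ 2 + s * dotv b xi + dotv xi (C *m xi).
Proof.
move=> ball.
(* Placing all of [b] in one off-diagonal block avoids halves; [s_lemma] asks for no symmetry. *)
pose P : 'M[R]_(1 + n) := block_mx a%:M b^T 0 C.
pose Q : 'M[R]_(1 + n) := block_mx 1%:M 0^T 0 (- 1%:M).
have dot0l (v : 'cV[R]_n) : dotv 0 v = 0 by rewrite dotvC dotv0r.
have PE s xi : dotv (col_mx s%:M xi) (P *m col_mx s%:M xi) =
    a * s ^+ 2 + s * dotv b xi + dotv xi (C *m xi).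
  by rewrite qform_block_mx dot0l addr0.
have QE s xi : dotv (col_mx s%:M xi) (Q *m col_mx s%:M xi) =
    s ^+ 2 - dotv xi xi.
  by rewrite qform_block_mx dot0l addr0 mulr0 mulNmx mul1mx dotvNr; ring.
have colE (v : 'cV[R]_(1 + n)) : v = col_mx (usubmx v 0 0)%:M (dsubmx v).
  by rewrite -mx11_scalar vsubmxK.
(* The centre of the ball is the strictly feasible point. *)
have [|v|lam lam0 lamP] := @s_lemma _ P Q (col_mx 1%:M 0).
- by rewrite QE dotv0r subr0 expr1n.
- rewrite (colE v); move: (usubmx v 0 0) (dsubmx v) => s xi; rewrite QE PE.
  (* The cone meets [s = 0] only at the origin; elsewhere, dividing by [s] lands in the ball. *)
  have [-> xi0|s0 le_xi] := eqVneq s 0.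
    have -> : xi = 0.
      by apply: dotv_eq0; apply/eqP; rewrite eq_le dotv_ge0; lra.
    by rewrite mulmx0 !dotv0r; lra.
  have s2 : 0 < s ^+ 2 by rewrite exprn_even_gt0.
  have := ball (s^-1 *: xi).
  rewrite -scalemxAr !(dotvZl, dotvZr) mulrA => ballx.
  have /ballx : s^-1 * s^-1 * dotv xi xi <= 1.
    rewrite -invfM -expr2 mulrC ler_pdivrMr //; lra.
  rewrite -(pmulr_rge0 _ s2); congr (0 <= _); by field.
by exists lam => // s xi; rewrite -PE -QE.
Qed.

Lemma psd_block_mx n (a : R) (b : 'cV[R]_n) (C : 'M[R]_n) :
  C^T = C ->
  psd (block_mx a%:M b^T b C) <-> forall s xi,
    0 <= a * s ^+ 2 + s * (dotv b xi + dotv b xi) + dotv xi (C *m xi).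
Proof.
move=> symC; split=> [[_ h] s xi|h]; first by rewrite -qform_block_mx.
split.
  by rewrite tr_block_mx trmxK symC tr_scalar_mx.
move=> v; have -> : v = col_mx (usubmx v 0 0)%:M (dsubmx v).
  by rewrite -mx11_scalar vsubmxK.
by rewrite qform_block_mx.
Qed.

End SLemma.

(** * Both constraints as quadratics in [xi], and the matrix inequalities as quadratic forms *)

Section Counterpart.
Variables (R : realType) (n L : nat) (A0 : 'M[R]_n) (A : 'I_L -> 'M[R]_n).
Variables (q0 : 'cV[R]_n) (q : 'I_L -> 'cV[R]_n) (x : 'cV[R]_n).

(** For fixed [x], this is the linear part of the affine map sending [xi] to the perturbed matrix
    applied to [x]. *)
Definition images_mx : 'M[R]_(n, L) := \matrix_(i, l) (A l *m x) i 0.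

Lemma images_mxE (xi : 'cV[R]_L) :
  images_mx *m xi = (\sum_(l < L) xi l 0 *: A l) *m x.
Proof.
apply/matrixP => i j; rewrite (ord1 j) mulmx_suml summxE mxE.
by apply: eq_bigr => l _; rewrite -scalemxAl !mxE mulrC.
Qed.

Definition obj_lin : 'cV[R]_L := \col_l dotv (q l) x.

Lemma obj_linE xi :
  dotv obj_lin xi = dotv x (\sum_(l < L) xi l 0 *: q l).
Proof.
rewrite dotvE dotvC /dotv linear_sum /= mulmx_suml summxE.
by apply: eq_bigr => l _; rewrite -/(dotv (_ *: q l) x) dotvZl mxE mulrC.
Qed.

Lemma objectiveE (xi : 'cV[R]_L) (Axi := A0 + \sum_(l < L) xi l 0 *: A l) :
  dotv x (Axi^T *m Axi *m x + (q0 + \sum_(l < L) xi l 0 *: q l)) =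
    dotv q0 x + dotv obj_lin xi
      + dotv (A0 *m x + images_mx *m xi) (A0 *m x + images_mx *m xi).
Proof.
rewrite images_mxE -mulmxDl -/Axi !dotvDr -obj_linE -mulmxA dotv_mulmxr trmxK.
by rewrite (dotvC x q0); ring.
Qed.

(** The right-hand side has the homogenised shape that [s_lemma_ball] produces; [s = 1] recovers the
    objective constraint with multiplier [tau]. *)
Lemma psd_objective t tau :
  psd (tau *: (block_mx (- 1%:M) 0
                        0        (block_mx 1%:M 0 0 0)
                 : 'M[R]_(1 + (L + n)))
       + t *: (block_mx 1%:M 0 0 0 : 'M[R]_(1 + (L + n)))
       + M0_mx A0 A q0 q x) <->
  forall s xi, tau * (s ^+ 2 - dotv xi xi) <=
    (t - dotv q0 x) * s ^+ 2 - s * dotv obj_lin xi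
      - dotv (s *: (A0 *m x) + images_mx *m xi)
             (s *: (A0 *m x) + images_mx *m xi).
Proof.
set X := (X in psd X).
pose b : 'cV[R]_(L + n) := col_mx (- 2^-1 *: obj_lin) (A0 *m x).
pose C : 'M[R]_(L + n) := block_mx tau%:M images_mx^T images_mx 1%:M.
have -> : X = block_mx (t - dotv q0 x - tau)%:M b^T b C.
  have qx : \col_l - (2^-1 * dotv (q l) x) = - 2^-1 *: obj_lin.
    by apply/matrixP => i j; rewrite !mxE mulNr.
  rewrite /X /M0_mx qx -tr_col_mx -/b -/images_mx.
  rewrite !scale_block_mx !add_block_mx !scaler0 !add0r !addr0.
  congr block_mx; last first.
    by rewrite scale_scalar_mx mulr1 add_block_mx !add0r addr0.
  by rewrite -raddfN !scale_scalar_mx -!raddfD /=; congr _%:M; ring.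
have symC : C^T = C by rewrite tr_block_mx trmxK !tr_scalar_mx.
rewrite psd_block_mx //.
(* Schur complement: [w = - z s xi] minimises the quadratic form over [w]. *)
pose z s xi := s *: (A0 *m x) + images_mx *m xi.
have formE s xi w : (t - dotv q0 x - tau) * s ^+ 2
    + s * (dotv b (col_mx xi w) + dotv b (col_mx xi w))
    + dotv (col_mx xi w) (C *m col_mx xi w) =
  (t - dotv q0 x) * s ^+ 2 - s * dotv obj_lin xi - dotv (z s xi) (z s xi)
    - tau * (s ^+ 2 - dotv xi xi) + dotv (w + z s xi) (w + z s xi).
  rewrite mul_block_col !dotv_col_mx !mul_scalar_mx !dotvDr.
  rewrite (dotv_mulmxr xi) trmxK.
  rewrite !dotvDl /z !(dotvDl, dotvDr, dotvZl, dotvZr) !(dotvC _ w).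
  by rewrite (dotvC (images_mx *m xi) (A0 *m x)); field.
split=> h s xi; last first.
  rewrite -(vsubmxK xi) formE addr_ge0 ?dotv_ge0 // subr_ge0; exact: h.
have := h s (col_mx xi (- z s xi)).
by rewrite formE addNr dotv0r addr0 subr_ge0.
Qed.

(** Here [- y1] plays the part of the S-lemma multiplier, and [- y2] stands for the constant
    coefficient minus that multiplier. *)
Lemma psd_row i y1 y2 :
  psd (y1 *: (block_mx 0 0 0 (- 1%:M) : 'M[R]_(1 + L))
       + y2 *: (block_mx (- 1%:M) 0 0 0 : 'M[R]_(1 + L))
       + Mi_mx A0 A q i x) <->
  forall s xi, 0 <= - y2 * s ^+ 2 + s * dotv (b_coef A0 A q i x) xi
    + dotv xi (C_coef A i x *m xi) - y1 * dotv xi xi.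
Proof.
set X := (X in psd X).
have -> : X = block_mx (- y2)%:M (2^-1 *: b_coef A0 A q i x)^T
    (2^-1 *: b_coef A0 A q i x) (C_coef A i x - y1%:M).
  rewrite /X /Mi_mx !scale_block_mx !add_block_mx !scaler0 !add0r !addr0.
  rewrite linearZ /=.
  congr block_mx; first by rewrite -raddfN !scale_scalar_mx mulrN1.
  by rewrite scalerN scale_scalar_mx mulr1 addrC.
rewrite psd_block_mx; last first.
  rewrite linearB /= tr_scalar_mx; congr (_ - _).
  by apply/matrixP => l m; rewrite !mxE; congr (_ * _); apply: eq_bigr => k _;
     rewrite !mxE addrC.
have formE s xi : - y2 * s ^+ 2
    + s * (dotv (2^-1 *: b_coef A0 A q i x) xi
           + dotv (2^-1 *: b_coef A0 A q i x) xi)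
    + dotv xi ((C_coef A i x - y1%:M) *m xi) =
  - y2 * s ^+ 2 + s * dotv (b_coef A0 A q i x) xi
    + dotv xi (C_coef A i x *m xi) - y1 * dotv xi xi.
  by rewrite dotvZl mulmxBl mul_scalar_mx dotvDr dotvNr dotvZr; field.
by split=> h s xi; [rewrite -formE|rewrite formE].
Qed.

Lemma constraint_rowE i
    (xi : 'cV[R]_L) (Axi := A0 + \sum_(l < L) xi l 0 *: A l) :
  (Axi^T *m Axi *m x + (q0 + \sum_(l < L) xi l 0 *: q l)) i 0 =
    a_coef A0 q0 i x + dotv (b_coef A0 A q i x) xi
      + dotv xi (C_coef A i x *m xi).
Proof.
(* [T] is bilinear: expanding it at the perturbed matrix yields the constant, linear and quadratic
   terms in [xi]. *)
pose T (M N : 'M[R]_n) := (M^T *m N *m x) i 0.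
have bE : dotv (b_coef A0 A q i x) xi =
    \sum_l xi l 0 * T (A l) A0 + \sum_l xi l 0 * T A0 (A l)
      + (\sum_(l < L) xi l 0 *: q l) i 0.
  rewrite dotvE summxE -!big_split; apply: eq_bigr => l _ /=.
  by rewrite mxE row_mulE mulmxDl mxE [(_ *: q l) i 0]mxE -!/(T _ _); ring.
have CE : dotv xi (C_coef A i x *m xi) =
    \sum_l \sum_m xi l 0 * xi m 0 * T (A l) (A m).
  transitivity (2^-1 * (\sum_l \sum_m xi l 0 * xi m 0 * T (A l) (A m)
      + \sum_l \sum_m xi l 0 * xi m 0 * T (A m) (A l))).
    rewrite -big_split mulr_sumr dotvE; apply: eq_bigr => l _ /=.
    rewrite mxE -big_split !mulr_sumr; apply: eq_bigr => m _ /=.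
    by rewrite mxE row_mulE mulmxDl mxE /T; ring.
  (* Swapping [l] and [m] shows that the two halves of the symmetrised coefficient contribute
     equally. *)
  rewrite [X in _ + X]exchange_big /=.
  under [X in _ + X]eq_bigr => l _ do under eq_bigr => m _ do
    rewrite (mulrC (xi m 0)).
  by field.
have TDl M N P : T (M + N) P = T M P + T N P.
  by rewrite /T raddfD !mulmxDl mxE.
have TDr M N P : T M (N + P) = T M N + T M P.
  by rewrite /T mulmxDr mulmxDl mxE.
have Tl N : T (\sum_(l < L) xi l 0 *: A l) N = \sum_l xi l 0 * T (A l) N.
  rewrite /T linear_sum /= !mulmx_suml summxE; apply: eq_bigr => l _.
  by rewrite linearZ /= -!scalemxAl mxE.
have Tr M : T M (\sum_(l < L) xi l 0 *: A l) = \sum_l xi l 0 * T M (A l).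
  rewrite /T mulmx_sumr mulmx_suml summxE; apply: eq_bigr => l _.
  by rewrite -scalemxAr -scalemxAl mxE.
have TBB : T (\sum_(l < L) xi l 0 *: A l) (\sum_(l < L) xi l 0 *: A l) =
    \sum_l \sum_m xi l 0 * xi m 0 * T (A l) (A m).
  rewrite Tl; apply: eq_bigr => l _; rewrite Tr mulr_sumr.
  by apply: eq_bigr => m _; rewrite mulrA.
rewrite bE CE -TBB -Tl -Tr /a_coef row_mulE -/(T A0 A0) mxE -/(T Axi Axi).
by rewrite [(q0 + _) i 0]mxE /Axi !(TDl, TDr); ring.
Qed.

End Counterpart.

Theorem theorem3p7 (R : realType) (n L : nat) (hL : (0 < L)%N)
    (A0 : 'M[R]_n) (A : 'I_L -> 'M[R]_n)
    (q0 : 'cV[R]_n) (q : 'I_L -> 'cV[R]_n)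
    (x : 'cV[R]_n) (t : R) :
  semi_infinite_feasible (uncertainty_set A0 A q0 q) x t <->
  exists (tau : R) (y1 y2 : 'I_n -> R),
    sdp_feasible A0 A q0 q t tau x y1 y2.
Proof.
split=> [[obj rows x0]|[tau [y1 [y2 [/psd_objective obj rows y12 y10 x0]]]]].
- have inU xi : dotv xi xi <= 1 -> uncertainty_set A0 A q0 q
    ((A0 + \sum_(l < L) xi l 0 *: A l)^T *m (A0 + \sum_(l < L) xi l 0 *: A l),
     q0 + \sum_(l < L) xi l 0 *: q l).
    by move=> xi1; exists xi; rewrite norm2_le1.
  pose Z := images_mx A x; pose c := A0 *m x.
  (* These are the coefficients in [xi] of [t] minus the objective, with the square of [c + Z *m xi]
     expanded. *)
  have [xi xi1|tau tau0 tauP] := @s_lemma_ball R L (t - dotv q0 x - dotv c c)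
      (- obj_lin q x - 2 *: (Z^T *m c)) (- (Z^T *m Z)).
    have := obj _ _ (inU xi xi1); rewrite objectiveE -subr_ge0; congr (0 <= _).
    rewrite mulNmx dotvNr -mulmxA (dotv_mulmxr xi Z^T) trmxK.
    rewrite !(dotvDl, dotvDr, dotvNl, dotvZl) -(dotv_mulmxr c).
    by rewrite (dotvC (_ *m xi) c) -/Z -/c; ring.
  have /choice[lam lamP] : forall i, exists lam, 0 <= lam /\
      forall s xi, lam * (s ^+ 2 - dotv xi xi) <= a_coef A0 q0 i x * s ^+ 2
        + s * dotv (b_coef A0 A q i x) xi + dotv xi (C_coef A i x *m xi).
    move=> i; have [xi xi1|l l0 lP] := @s_lemma_ball R L (a_coef A0 q0 i x)
        (b_coef A0 A q i x) (C_coef A i x); last by exists l.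
    by rewrite -constraint_rowE; exact: rows (inU xi xi1) i.
  (* This choice makes the scalar constraint on [y1] and [y2] an equality. *)
  exists tau, (fun i => - lam i), (fun i => lam i - a_coef A0 q0 i x).
  split=> //.
  + apply/psd_objective => s xi; have := tauP s xi; congr (_ <= _).
    rewrite mulNmx dotvNr -mulmxA (dotv_mulmxr xi Z^T) trmxK.
    rewrite !(dotvDl, dotvDr, dotvNl, dotvZl, dotvZr) -(dotv_mulmxr c).
    by rewrite (dotvC (_ *m xi) c) -/Z -/c; ring.
  + move=> i; apply/psd_row => s xi.
    have [_ /(_ s xi)] := lamP i; rewrite -subr_ge0; congr (0 <= _); ring.
  + by move=> i; rewrite addKr addNr.
  + by move=> i; rewrite oppr_le0; have [] := lamP i.
(* The sign of [tau] is hidden in the matrix inequality: at [s = 0] and a unit vector [e], available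
   since [0 < L], it bounds [tau] below by a squared norm. *)
- have tau0 : 0 <= tau.
    pose l0 := Ordinal hL; pose e : 'cV[R]_L := delta_mx l0 0.
    have ee : dotv e e = 1.
      rewrite dotvE (bigD1 l0) //= big1 => [|i il0]; rewrite !mxE.
        by rewrite !eqxx mulr1 addr0.
      by rewrite (negbTE il0) mul0r.
    have := obj 0 e; rewrite ee scale0r add0r.
    by have := dotv_ge0 (images_mx A x *m e); lra.
  split=> // M r [xi [+ [/= -> ->]]]; rewrite norm2_le1 => xi1.
  + rewrite objectiveE; have := obj 1 xi; rewrite scale1r.
    have : 0 <= tau * (1 - dotv xi xi) by rewrite mulr_ge0 // subr_ge0.
    lra.
  (* At [s = 1] the row value is at least [a_coef + y2 + y1 * dotv xi xi], hence at least
     [a_coef + y2 + y1], because [y1 <= 0] and [xi] lies in the ball. *)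
  + move=> i; rewrite constraint_rowE; have /psd_row/(_ 1 xi) := rows i.
    have := y12 i; have : y1 i * 1 <= y1 i * dotv xi xi by rewrite ler_wnM2l.
    lra.
Qed.
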